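(* Let $G$ be a connected graph with a fixed vertex $v_0$, let $m \ge 2$, let $G(m)$ be as defined below, and let $i$ be a positive integer. (i) If $\mathcal{D}_w(G(m-1), i-1) = \emptyset$ and $\mathcal{D}_w(G(m-2), i-1) \ne \emptyset$, then $\mathcal{D}_w(G(m), i) = \{\{y_{m-1}\} \cup X : X \in \mathcal{D}_w(G(m-2), i-1)\}$. (ii) If $\mathcal{D}_w(G(m-2), i-1) \ne \emptyset$ and $\mathcal{D}_w(G(m-1), i-1) \ne \emptyset$, then $\mathcal{D}_w(G(m), i) = \{\{y_m\} \cup X_1 : X_1 \in \mathcal{D}_w(G(m-1), i-1)\} \cup \{\{y_{m-1}\} \cup X_2 : X_2 \in \mathcal{D}_w(G(m-2), i-1)\}$.
   Context: All graphs are finite and simple. For a connected graph $H$, a non-empty set $S \subseteq V(H)$ is a weakly connected dominating set of $H$ if the spanning subgraph of $H$ obtained by removing all edges joining two vertices of $V(H)\setminus S$ is connected. $\mathcal{D}_w(H,i)$ is the family of weakly connected dominating sets of $H$ of cardinality $i$. For $m\ge 0$, let $P_{m+1}$ be a path with vertices $y_0,y_1,\dots,y_m$ (edges $y_{k-1}y_k$); $G(m)$ is the graph obtained from $G$ and $P_{m+1}$ by identifying the vertex $v_0$ of $G$ with the end vertex $y_0$ of the path (so $G(0)=G$ and $G(k-1)$ is $G(k)$ with $y_k$ deleted). *)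

(* Defs.v *)
From mathcomp Require Import all_boot.
Set Implicit Arguments.
Unset Strict Implicit.
Unset Printing Implicit Defensive.

Record sgraph := SGraph {
  vertex :> finType;
  adj : rel vertex;
  adj_sym : symmetric adj;
  adj_irr : irreflexive adj }.

Definition connected (H : sgraph) : bool :=
  [forall x : H, forall z : H, connect (@adj H) x z].

Section WeaklyConnectedDomination.
Variables (H : sgraph) (S : {set H}).

Definition weak_adj : rel H :=
  fun x z => adj x z && ~~ ((x \in ~: S) && (z \in ~: S)).

Fact weak_adj_sym : symmetric weak_adj.
Proof. by move=> x z; rewrite /weak_adj adj_sym [(x \in _) && _]andbC. Qed.

Fact weak_adj_irr : irreflexive weak_adj.
Proof. by move=> x; rewrite /weak_adj adj_irr. Qed.

Definition weak_subgraph : sgraph := SGraph weak_adj_sym weak_adj_irr.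

Definition wcds : bool := (S != set0) && connected weak_subgraph.

End WeaklyConnectedDomination.

Definition Dw (H : sgraph) (i : nat) : {set {set H}} :=
  [set S : {set H} | wcds S & #|S| == i].

Section AttachPath.
Variables (G : sgraph) (v0 : G) (m : nat).

(* In G + 'I_m the element inr j stands for y_(j+1); the path vertex y_0 is   *)
(* identified with v0, i.e. with inl v0.                                      *)
Definition path_vertex (k : 'I_m.+1) : G + 'I_m :=
  if unlift ord0 k is Some j then inr j else inl v0.

Definition G_adj : rel (G + 'I_m) := fun x z =>
  match x, z with inl a, inl b => adj a b | _, _ => false end.

Definition path_adj : rel (G + 'I_m) := fun x z =>
  [exists j : 'I_m.+1, exists k : 'I_m.+1,
    [&& x == path_vertex j, z == path_vertex k
      & (j.+1 == k :> nat) || (k.+1 == j :> nat)]].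

Definition attach_adj : rel (G + 'I_m) := fun x z => G_adj x z || path_adj x z.

Fact path_vertex_inj : injective path_vertex.
Proof.
move=> j k; rewrite /path_vertex.
by case: unliftP => [j' ->|->]; case: unliftP => [k' ->|->] // [->].
Qed.

Fact attach_adj_sym : symmetric attach_adj.
Proof.
move=> x z; congr (_ || _); first by case: x z => [a|j] [b|k] //=; exact: adj_sym.
by apply/idP/idP => /existsP[j /existsP[k /and3P[xj zk jk]]];
  apply/existsP; exists k; apply/existsP; exists j; rewrite xj zk orbC.
Qed.

Fact attach_adj_irr : irreflexive attach_adj.
Proof.
move=> x; apply/negbTE; rewrite negb_or; apply/andP; split.
  by case: x => [a|j] //=; rewrite adj_irr.
apply/negP => /existsP[j /existsP[k /and3P[/eqP-> /eqP/path_vertex_inj->]]].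
by rewrite orbb eqn_leq ltnn.
Qed.

Definition attach_path : sgraph := SGraph attach_adj_sym attach_adj_irr.

End AttachPath.

(* attach_path v0 k is the subgraph of attach_path v0 m induced on the vertices*)
(* of G and y_0, ..., y_k; this is the inclusion of its vertex set.            *)
Definition attach_incl (G : sgraph) (v0 : G) (k m : nat) (le_km : k <= m)
    (x : attach_path v0 k) : attach_path v0 m :=
  match x with inl a => inl a | inr j => inr (widen_ord le_km j) end.

(* Main.v *)
(* Both path steps, from G(m-2) to G(m-1) and from G(m-1) to G(m), add a pendant
   vertex w with neighbour u.  A set S is weakly connected dominating after
   adding w iff its trace is so before and the edge uw meets S, up to the trace
   being empty, which the cardinality hypotheses exclude.  A set S in G(m) either
   contains y_m, or else contains y_(m-1) and its trace on G(m-1) again contains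
   the pendant vertex. *)
Require Import Defs.
From mathcomp Require Import all_boot.
Set Implicit Arguments.
Unset Strict Implicit.
Unset Printing Implicit Defensive.

(** An edge of [e] may go to a path of [e'], even an empty one; this lets a retraction contract the
    pendant edge. *)
Lemma connect_homo (T T' : finType) (e : rel T) (e' : rel T') (h : T -> T') :
  (forall x z, e x z -> connect e' (h x) (h z)) ->
  forall x z, connect e x z -> connect e' (h x) (h z).
Proof.
move=> he x z /connectP[p]; elim: p x => [|y p IHp] x /=; first by move=> _ ->.
by case/andP=> /he xy yp zE; apply: connect_trans xy (IHp y yp zE).
Qed.

(** [H] is [H'] with a leaf [w] hung at [f u]. The embedding [f] is needed because the graphs G(k)
    have different vertex types. *)
Record pendant_extension (H' H : sgraph) (f : H' -> H) (u : H') (w : H) : Prop :=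
  PendantExtension {
    pendant_inj : injective f;
    pendant_adj : forall x z, adj (f x) (f z) = adj x z;
    pendant_notin : forall x, f x != w;
    pendant_cover : forall z, z <> w -> exists x, z = f x;
    pendant_nbr : forall x, adj w (f x) = (x == u) }.

Section Pendant.
Variables (H' H : sgraph) (f : H' -> H) (u : H') (w : H).
Hypothesis pend : pendant_extension f u w.
Implicit Types (S : {set H}) (X : {set H'}).

Let f_inj : injective f := pendant_inj pend.

Lemma weak_adj_preim S x z : weak_adj S (f x) (f z) = weak_adj (f @^-1: S) x z.
Proof. by rewrite /weak_adj (pendant_adj pend) !inE. Qed.

Lemma weak_adj_pendant S x :
  weak_adj S w (f x) = (x == u) && ((w \in S) || (f u \in S)).
Proof.
rewrite /weak_adj (pendant_nbr pend) !inE negb_and !negbK.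
by case: eqVneq => [->|].
Qed.

(** Contracting the pendant edge turns walks of [H] into walks of [H']. Conversely, walks lift along
    [f], and [w] is joined to them exactly when the pendant edge has an end in [S]. *)
Lemma connected_pendant S :
  connected (weak_subgraph S) =
  connected (weak_subgraph (f @^-1: S)) && ((w \in S) || (f u \in S)).
Proof.
(* [r] inverts [f]; since [w] has no preimage, the default value sends it to [u]. *)
pose r z := odflt u [pick x | f x == z].
have rf x : r (f x) = x.
  by rewrite /r; case: pickP => [y /eqP/f_inj|/(_ x)]; rewrite ?eqxx.
have rw : r w = u.
  by rewrite /r; case: pickP => [y /idPn[]|//]; apply: pendant_notin pend y.
apply/idP/andP => [conS | [conS' uwS]].
  have conSP x z : connect (weak_adj S) x z.
    by have /forallP/(_ x)/forallP/(_ z) := conS.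
  split.
    apply/forallP => x; apply/forallP => z /=; rewrite -[x]rf -[z]rf.
    apply: connect_homo (conSP (f x) (f z)) => {}x {}z.
    (* An edge at [w] has its other end at [f u], so [r] collapses it to [u]; every other edge is
       the image of an edge of [H']. *)
    have [->|/eqP/(pendant_cover pend)[{}x ->]] := eqVneq x w.
      have [->//|/eqP/(pendant_cover pend)[{}z ->]] := eqVneq z w.
      by rewrite weak_adj_pendant rw rf => /andP[/eqP->].
    have [->|/eqP/(pendant_cover pend)[{}z ->]] := eqVneq z w.
      by rewrite weak_adj_sym weak_adj_pendant rw rf => /andP[/eqP->].
    by rewrite weak_adj_preim !rf; apply: connect1.
  (* A walk from [w] to [f u] has a first edge, which can only be the pendant one, so that edge
     meets [S]. *)
  have /connectP[[|z p] /=] := conSP w (f u).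
    by move=> _ fuw; have := pendant_notin pend u; rewrite fuw eqxx.
  case/andP=> wz _ _; move: wz.
  have [->|/eqP/(pendant_cover pend)[{}z ->]] := eqVneq z w.
    by rewrite weak_adj_irr.
  by rewrite weak_adj_pendant => /andP[].
have con_u z : connect (weak_adj S) z (f u).
  have [->|/eqP/(pendant_cover pend)[x ->]] := eqVneq z w.
    by apply: connect1; rewrite weak_adj_pendant eqxx.
  have /forallP/(_ x)/forallP/(_ u) := conS'; apply: connect_homo => {}x y /=.
  by rewrite -weak_adj_preim; apply: connect1.
apply/forallP => x; apply/forallP => z /=; apply: connect_trans (con_u x) _.
by rewrite (sym_connect_sym (@weak_adj_sym H S)).
Qed.

Lemma pendant_imset_notin X : w \notin f @: X.
Proof.
by apply/imsetP => -[x _ wE]; have := pendant_notin pend x; rewrite -wE eqxx.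
Qed.

Lemma preim_pendantU X : f @^-1: (w |: f @: X) = X.
Proof.
by apply/setP=> x; rewrite !inE (mem_imset _ _ f_inj) (negPf (pendant_notin pend x)).
Qed.

Lemma preim_pendant X : f @^-1: (f @: X) = X.
Proof. by apply/setP=> x; rewrite !inE (mem_imset _ _ f_inj). Qed.

Lemma pendantD1 S : S :\ w = f @: (f @^-1: S).
Proof.
apply/setP=> z; rewrite !inE; have [->|/eqP/(pendant_cover pend)[x ->]] := eqVneq z w.
  by rewrite (negPf (pendant_imset_notin _)).
by rewrite (mem_imset _ _ f_inj) inE.
Qed.

Lemma Dw_pendantU X n : X \in Dw H' n -> w |: f @: X \in Dw H n.+1.
Proof.
rewrite !inE => /andP[/andP[_ conX] /eqP<-].
rewrite /wcds connected_pendant preim_pendantU conX setU11.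
rewrite cardsU1 pendant_imset_notin (card_imset _ f_inj) eqxx !andbT.
by apply/set0Pn; exists w; rewrite setU11.
Qed.

(** The bound [0 < n] excludes the singleton of [w], whose trace is empty. *)
Lemma Dw_pendant_in S n :
  0 < n -> S \in Dw H n.+1 -> w \in S -> f @^-1: S \in Dw H' n.
Proof.
rewrite !inE => n_gt0 /andP[/andP[_ conS] cardS] wS.
have cardS' : #|f @^-1: S| == n.
  by rewrite -(card_imset _ f_inj) -pendantD1; rewrite (cardsD1 w) wS in cardS.
rewrite /wcds cardS' -card_gt0 (eqP cardS') n_gt0 andbT.
by move: conS; rewrite connected_pendant => /andP[].
Qed.

(** The pendant edge must survive although [w] lies outside [S], which forces [f u] into [S]; hence
    the trace contains [u] and is non-empty. *)
Lemma Dw_pendant_notin S n :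
  S \in Dw H n -> w \notin S ->
  [/\ f u \in S, f @: (f @^-1: S) = S & f @^-1: S \in Dw H' n].
Proof.
rewrite !inE => /andP[/andP[S0 conS] cardS] wS.
have fS : f @: (f @^-1: S) = S.
  by rewrite -pendantD1; apply/setDidPl; rewrite disjoint_sym disjoints1.
move: conS; rewrite connected_pendant (negPf wS) => /andP[conS' uS].
split=> //; rewrite -(card_imset _ f_inj) fS cardS /wcds conS' !andbT.
by apply/set0Pn; exists u; rewrite inE.
Qed.

Lemma Dw_pendant_imset X n : u \in X -> X \in Dw H' n -> f @: X \in Dw H n.
Proof.
rewrite !inE => uX /andP[/andP[_ conX] cardX].
rewrite (card_imset _ f_inj) cardX /wcds connected_pendant preim_pendant conX.
rewrite (mem_imset _ _ f_inj) uX orbT !andbT.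
by apply/set0Pn; exists (f u); rewrite (mem_imset _ _ f_inj).
Qed.

End Pendant.

Section AttachIncl.
Variables (G : sgraph) (v0 : G).

Lemma attach_incl_inj k m (le_km : k <= m) : injective (attach_incl (v0 := v0) le_km).
Proof. by move=> [a|j] [b|l] //= [] => [->|/val_inj ->]. Qed.

Lemma attach_incl_comp k l m (le_kl : k <= l) (le_lm : l <= m) (le_km : k <= m) x :
  attach_incl le_lm (attach_incl (v0 := v0) le_kl x) = attach_incl le_km x.
Proof. by case: x => //= j; congr inr; apply: val_inj. Qed.

Lemma attach_incl_path_vertex k m (le_km : k <= m) (j : 'I_k.+1) (l : 'I_m.+1) :
  j = l :> nat ->
  attach_incl le_km (path_vertex v0 j : attach_path v0 k) = path_vertex v0 l.
Proof.
rewrite /path_vertex; case: unliftP => [j' ->|->]; case: unliftP => [l' ->|->] //=.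
by move=> [jl]; congr inr; apply: val_inj.
Qed.

(** Serves to pull path edges back to G(k) and to see that y_(k+1) is a new vertex. *)
Lemma attach_incl_path_vertexP k m (le_km : k <= m) (x : attach_path v0 k)
    (l : 'I_m.+1) :
  attach_incl le_km x = path_vertex v0 l ->
  exists2 j : 'I_k.+1, x = path_vertex v0 j & j = l :> nat.
Proof.
rewrite {1}/path_vertex; case: unliftP => [l' ->|->]; case: x => [a|j] //= [].
  by move=> <-; exists (lift ord0 j); rewrite // /path_vertex liftK.
by move=> ->; exists ord0; rewrite // /path_vertex unlift_none.
Qed.

Lemma attach_incl_adj k m (le_km : k <= m) (x z : attach_path v0 k) :
  adj (attach_incl le_km x) (attach_incl le_km z) = adj x z.
Proof.
rewrite /= /attach_adj; congr (_ || _); first by case: x z => [a|j] [b|l].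
apply/idP/idP => /existsP[j /existsP[l /and3P[/eqP xj /eqP zl jl]]].
  have [j' -> j'E] := attach_incl_path_vertexP xj.
  have [l' -> l'E] := attach_incl_path_vertexP zl.
  by apply/existsP; exists j'; apply/existsP; exists l'; rewrite !eqxx j'E l'E.
have le_km1 : k.+1 <= m.+1 by [].
apply/existsP; exists (widen_ord le_km1 j); apply/existsP; exists (widen_ord le_km1 l).
have inclE (J : 'I_k.+1) : attach_incl le_km (path_vertex v0 J : attach_path v0 k) =
    path_vertex v0 (widen_ord le_km1 J) by apply: attach_incl_path_vertex.
by rewrite xj zl !inclE !eqxx.
Qed.

(** The equation is a hypothesis because the lemma is applied to sizes such as [m] and [m - 1],
    which are not successors by conversion. The two [ord_max] stand for y_k in G(k) and y_(k+1) in
    G(m). *)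
Lemma attach_incl_pendant k m (le_km : k <= m) : m = k.+1 ->
  pendant_extension (attach_incl (v0 := v0) le_km)
    (path_vertex v0 ord_max) (path_vertex v0 ord_max).
Proof.
move=> mE; subst m.
have wE : path_vertex v0 (@ord_max k.+1) = inr ord_max.
  rewrite /path_vertex; case: unliftP => [j|] /(congr1 val) //= [jE].
  by congr inr; apply: val_inj.
split.
- exact: attach_incl_inj.
- exact: attach_incl_adj.
- move=> x; apply/eqP => /attach_incl_path_vertexP[j _] /= jE.
  by have := ltn_ord j; rewrite jE ltnn.
- rewrite wE => -[a|j] zw; first by exists (inl a).
  have jk : j < k.
    rewrite ltn_neqAle -ltnS ltn_ord andbT.
    by apply/eqP => jE; apply: zw; congr inr; apply: val_inj.
  by exists (inr (Ordinal jk)); congr inr; apply: val_inj.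
move=> x; rewrite /= /attach_adj {1}wE /=; apply/existsP/eqP => [[j]|->].
  (* The index of [w] is the largest one, so a successor is out of range and only the predecessor
     y_k remains. *)
  case/existsP=> l /and3P[/eqP/path_vertex_inj <- /eqP xl /= /orP[]] /eqP jl.
    by have := ltn_ord l; rewrite -jl ltnn.
  have [l' -> l'E] := attach_incl_path_vertexP xl; congr path_vertex.
  by apply: val_inj; case: jl => jl; rewrite /= l'E.
exists ord_max; apply/existsP; exists (inord k); rewrite eqxx inordK //= eqxx orbT andbT.
by apply/eqP/attach_incl_path_vertex; rewrite inordK.
Qed.

End AttachIncl.

Theorem theorem3p4 (G : sgraph) (hG : connected G) (v0 : G)
    (m : nat) (hm : 2 <= m) (i : nat) (hi : 0 < i) :
  (Dw (attach_path v0 (m - 1)) (i - 1) = set0 ->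
   Dw (attach_path v0 (m - 2)) (i - 1) <> set0 ->
   Dw (attach_path v0 m) i =
     [set (path_vertex v0 (inord (m - 1)) : attach_path v0 m)
            |: (attach_incl (leq_subr 2 m) @: X)
        | X : {set attach_path v0 (m - 2)} in Dw (attach_path v0 (m - 2)) (i - 1)])
  /\
  (Dw (attach_path v0 (m - 2)) (i - 1) <> set0 ->
   Dw (attach_path v0 (m - 1)) (i - 1) <> set0 ->
   Dw (attach_path v0 m) i =
     [set (path_vertex v0 ord_max : attach_path v0 m)
            |: (attach_incl (leq_subr 1 m) @: X1)
        | X1 : {set attach_path v0 (m - 1)} in Dw (attach_path v0 (m - 1)) (i - 1)]
     :|:
     [set (path_vertex v0 (inord (m - 1)) : attach_path v0 m)
            |: (attach_incl (leq_subr 2 m) @: X2)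
        | X2 : {set attach_path v0 (m - 2)} in Dw (attach_path v0 (m - 2)) (i - 1)]).
Proof.
case: i hi => // n _; rewrite [n.+1 - 1]subn1 [n.+1.-1]/=.
have m1E : m = (m - 1).+1 by rewrite subn1 prednK // ltnW.
have m2E : m - 1 = (m - 2).+1 by rewrite -subSn // subSS.
have le21 : m - 2 <= m - 1 by rewrite leq_sub2l.
have pend1 := attach_incl_pendant v0 (leq_subr 1 m) m1E.
have pend2 := attach_incl_pendant v0 le21 m2E.
have uE : attach_incl (leq_subr 1 m) (path_vertex v0 ord_max : attach_path v0 (m - 1))
    = path_vertex v0 (inord (m - 1)).
  by apply: attach_incl_path_vertex; rewrite inordK // ltnS leq_subr.
(* Factors the sets built from G(m-2) through G(m-1), where y_(m-1) is the pendant vertex. *)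
have im2E (X : {set attach_path v0 (m - 2)}) :
    path_vertex v0 (inord (m - 1)) |: attach_incl (leq_subr 2 m) @: X =
    attach_incl (leq_subr 1 m) @:
      ((path_vertex v0 ord_max : attach_path v0 (m - 1)) |: attach_incl le21 @: X).
  rewrite imsetU1 uE -imset_comp; congr (_ |: _); apply: eq_imset => x /=.
  exact/esym/attach_incl_comp.
(* Weakly connected dominating sets are non-empty, so the hypothesis on G(m-2) supplies the bound
   for [Dw_pendant_in]. *)
have n_gt0 : Dw (attach_path v0 (m - 2)) n <> set0 -> 0 < n.
  move=> /eqP/set0Pn[X]; rewrite inE => /andP[/andP[X0 _] /eqP<-].
  by rewrite card_gt0.
have from2 (X : {set attach_path v0 (m - 2)}) : X \in Dw (attach_path v0 (m - 2)) n ->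
    path_vertex v0 (inord (m - 1)) |: attach_incl (leq_subr 2 m) @: X
      \in Dw (attach_path v0 m) n.+1.
  (* Once y_(m-1) is in the set, the edge to y_m survives. *)
  move=> XD; rewrite im2E; apply: (Dw_pendant_imset pend1); first exact: setU11.
  exact: (Dw_pendantU pend2).
have to2 (S : {set attach_path v0 m}) : 0 < n -> S \in Dw (attach_path v0 m) n.+1 ->
    path_vertex v0 ord_max \notin S ->
    S \in [set (path_vertex v0 (inord (m - 1)) : attach_path v0 m)
            |: (attach_incl (leq_subr 2 m) @: X)
        | X : {set attach_path v0 (m - 2)} in Dw (attach_path v0 (m - 2)) n].
  move=> n0 SD wS; have [uS SE S'D] := Dw_pendant_notin pend1 SD wS.
  have uS' : path_vertex v0 ord_max \in attach_incl (leq_subr 1 m) @^-1: S.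
    by rewrite inE.
  (* The witness is the trace of [S] on G(m-2): y_m is absent from [S], and y_(m-1), present by
     [uS'], is removed. *)
  apply/imsetP; exists (attach_incl le21 @^-1: (attach_incl (leq_subr 1 m) @^-1: S)).
    exact: Dw_pendant_in pend2 _ _ n0 S'D uS'.
  by rewrite im2E -(pendantD1 pend2) setD1K // SE.
split=> [D1 D2 | D2 D1]; have n0 := n_gt0 D2; apply/setP => S.
  apply/idP/imsetP => [SD | [X XD ->]]; last exact: from2.
  (* If y_m were in [S], removing it would leave a member of the family of G(m-1), which is empty by
     [D1]. *)
  apply/imsetP/to2 => //; apply/negP => wS.
  by have := Dw_pendant_in pend1 n0 SD wS; rewrite D1 inE.
apply/idP/setUP => [SD | [] /imsetP[X XD ->]]; last exact: from2.
  have [wS|wS] := boolP (path_vertex v0 ord_max \in S); last by right; apply: to2.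
  left; apply/imsetP; exists (attach_incl (leq_subr 1 m) @^-1: S).
    exact: Dw_pendant_in pend1 _ _ n0 SD wS.
  by rewrite -(pendantD1 pend1) setD1K.
exact: (Dw_pendantU pend1).
Qed.
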